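(* Let $\varepsilon \in (0,1)$, $n_1, n_2 \in \mathbb{N}$, and $r = \lceil 9 \log(3 n_1 n_2)/\varepsilon^2 \rceil$. Let $\sigma, R > 0$, let $\Omega \subset \mathbb{R}$ be an interval with $[-4\sigma R^2, 4\sigma R^2] \subseteq \Omega$, and let $h : \Omega \to \mathbb{R}$ be a bounded function in $C^\infty(\Omega)$ such that, for some constants $C \geq 0$ and $M > 0$, $\|h^{(s)}\|_{L_\infty(\Omega)} \leq C M^s$ for all $s \in \mathbb{N}_0$. Let $m \in \mathbb{N}$ and let $W \in \mathbb{R}^{m \times m}$ be symmetric positive-definite with $\|W\|_2 \leq \sigma$. Then for every matrix $F \in \mathbb{R}^{n_1 \times n_2}$ of the form $F(i,j) = h(\|x_i - y_j\|_W^2)$ with points $\{x_i\}_{i=1}^{n_1}, \{y_j\}_{j=1}^{n_2} \subset \overline{\mathbb{B}}_{m,R}$, and for every integer $t \geq 4 e^2 M \|W\|_2 R^2$, there exists $G \in \mathbb{R}^{n_1 \times n_2}$ with $\mathrm{rank}(G) \leq 1 + (t-1) r$ such that $$\|F - G\|_{\max} \leq C \left[ e^{-t} + \varepsilon \left( e^{4 M \|W\|_2 R^2} - 1 \right) \right].$$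
   Context: $\mathbb{N} = \{1,2,\ldots\}$ and $\mathbb{N}_0 = \{0,1,2,\ldots\}$; $\log$ is the natural logarithm and $e$ is Euler's number. $\|F\|_{\max} = \max_{i,j} |F(i,j)|$; $\|W\|_2$ is the spectral norm; $\|x\|_W = \sqrt{x^\top W x}$; $\overline{\mathbb{B}}_{m,R} = \{x \in \mathbb{R}^m : \|x\|_2 \leq R\}$. For a function $g$ on $\Omega$, $\|g\|_{L_\infty(\Omega)} = \sup_{x \in \Omega} |g(x)|$, and $h^{(s)}$ is the $s$-th derivative of $h$. *)

(* Defs.v *)
From HB Require Import structures.
From mathcomp Require Import all_boot all_order all_algebra.
From mathcomp Require Import all_classical all_reals all_analysis.
Set Implicit Arguments.
Unset Strict Implicit.
Unset Printing Implicit Defensive.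
Import Order.TTheory GRing.Theory Num.Theory.
Import numFieldNormedType.Exports.
Local Open Scope classical_set_scope.
Local Open Scope ring_scope.

Section Norms.
Variable K : realType.

(* The library norm on matrices is the entrywise maximum, so the Euclidean
   norm has to be defined separately. *)
Definition euclid_norm (m : nat) (x : 'cV[K]_m) : K :=
  Num.sqrt (\sum_(i < m) x i 0 ^+ 2).

Definition spectral_norm (m : nat) (W : 'M[K]_m) : K :=
  sup [set euclid_norm (W *m x) | x in [set x | euclid_norm x <= 1]].

Definition sym_posdef (m : nat) (W : 'M[K]_m) : Prop :=
  W^T = W /\ forall x : 'cV[K]_m, x != 0 -> 0 < (x^T *m W *m x) 0 0.

Definition wnorm (m : nat) (W : 'M[K]_m) (x : 'cV[K]_m) : K :=
  Num.sqrt ((x^T *m W *m x) 0 0).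

End Norms.

Section SmoothOnInterval.
Variable K : realType.

(* A function on Omega is a total function whose values outside Omega are never
   used. Difference quotients run over points of Omega only, so the derivative
   is one-sided at an endpoint belonging to Omega. *)
Definition diffquot_within (Omega : set K) (f : K -> K) (x : K) :
    set_system K :=
  (f y - f x) / (y - x) @[y --> within Omega x^'].

Definition derivable_within (Omega : set K) (f : K -> K) (x : K) : Prop :=
  cvg (diffquot_within Omega f x).

Definition derive_within (Omega : set K) (f : K -> K) (x : K) : K :=
  lim (diffquot_within Omega f x).

Definition nderive_within (Omega : set K) (s : nat) (f : K -> K) : K -> K :=
  iter s (derive_within Omega) f.

Definition smooth_on (Omega : set K) (f : K -> K) : Prop :=
  forall (s : nat) (x : K), Omega x ->
    derivable_within Omega (nderive_within Omega s f) x.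

(* Extended-real supremum: the real-valued sup of an unbounded set is 0. *)
Definition sup_norm_on (Omega : set K) (g : K -> K) : \bar K :=
  ereal_sup [set (`|g x|)%:E | x in Omega].

End SmoothOnInterval.

(* Main.v *)
(** Truncate the Taylor series of [h] at 0: with [rho = 4 |W| R^2] the
    remainder is at most [C (M rho)^t / t! <= C e^-t], and what is left is a
    combination of the Hadamard powers of the matrix
    [z i j = |x_i - y_j|_W^2].  Writing [z] as a Gram matrix [<u_i, v_j>] with
    [|u_i|^2, |v_j|^2 <= rho], its [s]-th Hadamard power is the Gram matrix of
    the tensor powers, and projecting those on [r] sign vectors approximates
    it entrywise up to [eps rho^s] by a matrix of rank [r].  Summing over [s]
    gives [C eps (e^(M rho) - 1)].

    The sign vectors are chosen by the method of conditional expectations, so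
    no probability space appears.  By polarization it is enough to control
    [sum_k <g_k, p>^2] for the [2 n1 n2] vectors [p = (u_i +- v_j) / 2]; the
    failure probability is at most [e^(-r eps^2/8)] for the upper tail and
    [e^(-r eps^2/6)] for the lower one. *)

Require Import Defs.
From HB Require Import structures.
From mathcomp Require Import all_boot all_order all_algebra.
From mathcomp Require Import all_classical all_reals all_analysis.
From mathcomp Require Import ring lra.
Set Implicit Arguments.
Unset Strict Implicit.
Unset Printing Implicit Defensive.
Import Order.TTheory GRing.Theory Num.Theory.
Import numFieldNormedType.Exports.
Local Open Scope classical_set_scope.
Local Open Scope ring_scope.

(** * Exponential inequalities from the power series *)

Lemma expR_ge_partial_sum (K : realType) (x : K) (n : nat) : 0 <= x ->
  \sum_(i < n) x ^+ i / i`!%:R <= expR x.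
Proof.
move=> x0; rewrite -(big_mkord xpredT (fun i => x ^+ i / i`!%:R)).
apply: (@nondecreasing_cvgn_le _ (series (exp_coeff x))).
  by apply: nondecreasing_series => i _ _; exact: exp_coeff_ge0.
exact: is_cvg_series_exp_coeff.
Qed.

Lemma expR_ge_quadratic (K : realType) (x : K) : 0 <= x ->
  1 + x + x ^+ 2 / 2 <= expR x.
Proof.
move=> x0; have := expR_ge_partial_sum 3 x0.
by rewrite !big_ord_recr big_ord0 /= add0r expr0 expr1 !divr1.
Qed.

Lemma fact_double_ge (n : nat) : (2 ^ n * n`! <= (n.*2)`!)%N.
Proof.
elim: n => // n IH; rewrite doubleS !factS expnS.
have -> : (2 * 2 ^ n * (n.+1 * n`!) = (2 * n.+1) * (2 ^ n * n`!))%N by ring.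
rewrite [leqRHS]mulnA leq_mul// mul2n doubleS.
by rewrite -{1}[n.*2.+2]muln1 leq_mul2l.
Qed.

(** Compare power series termwise: the odd terms cancel, and [x^(2k) / (2k)!] is at most
    [(x^2 / 2)^k / k!] because [2^k k! <= (2k)!]. *)
Lemma expR_add_expRN_le (K : realType) (x : K) :
  (expR x + expR (- x)) / 2 <= expR (x ^+ 2 / 2).
Proof.
rewrite ler_pdivrMr// mulrC.
pose c k := (x ^+ k + (- x) ^+ k) / k`!%:R.
have c0 k : 0 <= c k.
  rewrite /c divr_ge0// exprNn; case: (boolP (odd k)) => ok.
    by rewrite -signr_odd ok expr1 mulN1r subrr.
  by rewrite -signr_odd (negbTE ok) expr0 mul1r addr_ge0//
    -[k]odd_double_half (negbTE ok) add0n -mul2n exprM exprn_ge0// sqr_ge0.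
have codd k : c k.*2.+1 = 0.
  by rewrite /c exprNn -signr_odd /= odd_double expr1 mulN1r subrr mul0r.
have ceven k : c k.*2 <= 2 * ((x ^+ 2 / 2) ^+ k / k`!%:R).
  rewrite /c exprNn -signr_odd odd_double expr0 mul1r.
  have -> (z w : K) : (z + z) / w = 2 * (z / w) by ring.
   rewrite ler_wpM2l// expr_div_n -exprM mul2n -mulrA -invfM.
  rewrite ler_wpM2l//; first by rewrite -mul2n exprM exprn_ge0// sqr_ge0.
  rewrite lef_pV2 ?posrE ?mulr_gt0 ?exprn_gt0 ?ltr0n ?fact_gt0//.
  by rewrite -natrX -natrM ler_nat fact_double_ge.
have cS n : \sum_(i < n.*2) c i <= 2 * expR (x ^+ 2 / 2).
  apply: (@le_trans _ _ (2 * \sum_(i < n) (x ^+ 2 / 2) ^+ i / i`!%:R)); last first.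
    by rewrite ler_wpM2l// expR_ge_partial_sum// divr_ge0// sqr_ge0.
  rewrite mulr_sumr; elim: n => [|n IH]; first by rewrite !big_ord0.
  by rewrite doubleS !big_ord_recr /= codd addr0 lerD.
have cvg1 := @is_cvg_series_exp_coeff K x.
have cvg2 := @is_cvg_series_exp_coeff K (- x).
rewrite /expR -(limD cvg1 cvg2); apply: limr_le; first exact: is_cvgD.
near=> n; rewrite fctE /=.
apply: le_trans (cS n).
(* Every [c i] is nonnegative, so moving the cutoff from [n] to [n.*2] only increases the sum and
   makes [cS] applicable. *)
rewrite /series /= -big_split /= -(big_mkord xpredT c).
have -> : \sum_(0 <= i < n.*2) c i = \sum_(0 <= i < n) c i + \sum_(n <= i < n.*2) c i.
  by apply: big_cat_nat; rewrite // -addnn leq_addr.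
rewrite (eq_bigr c (F1 := fun i => _ + _)) => [|i _]; last by rewrite /c mulrDl.
by rewrite lerDl sumr_ge0.
Unshelve. all: by end_near. Qed.

(** * Gaussian potentials for the two tails *)

Section SignPotentials.
Variable K : realType.
Implicit Types s a p P : K.

(* For a standard Gaussian [xi], the two potentials are the expectations of
   [expR (s * X ^+ 2)] and of [1 - s * X ^+ 2 + (s * X ^+ 2) ^+ 2 / 2], where
   [X = a + Num.sqrt P * xi]. *)
Definition upper_potential s a P : K :=
  expR (s * a ^+ 2 / (1 - 2 * s * P) - ln (1 - 2 * s * P) / 2).

Definition lower_potential s a P : K :=
  1 - s * (a ^+ 2 + P) + s ^+ 2 / 2 * (a ^+ 4 + 6 * a ^+ 2 * P + 3 * P ^+ 2).

(** Factoring out the common exponential leaves a hyperbolic cosine, bounded by [expR_add_expRN_le].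
    With [y = 2 * s * p ^+ 2 / D], the denominator on the right is [D * (1 - y)], and
    [ln (1 - y) <= - y] together with [1 + y <= (1 - y)^-1] absorbs the rest. *)
Lemma upper_potential_avg s a p P : 0 <= s -> 2 * s * (P + p ^+ 2) < 1 ->
  (upper_potential s (a + p) P + upper_potential s (a - p) P) / 2
    <= upper_potential s a (P + p ^+ 2).
Proof.
move=> s0 H; rewrite /upper_potential.
set D := 1 - 2 * s * P; set D' := 1 - 2 * s * (P + p ^+ 2).
have sp0 : 0 <= s * p ^+ 2 by rewrite mulr_ge0// sqr_ge0.
have D'0 : 0 < D' by rewrite subr_gt0.
have DD' : D' = D - 2 * (s * p ^+ 2) by rewrite /D /D'; ring.
have D0 : 0 < D by lra.
pose c := s / D.
have c0 : 0 <= c by rewrite divr_ge0// ltW.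
pose y := 2 * c * p ^+ 2.
have y0 : 0 <= y by rewrite mulr_ge0 ?sqr_ge0// mulr_ge0.
have D'E : D' = D * (1 - y) by rewrite DD' /y /c; field; rewrite gt_eqF.
have y1 : 0 < 1 - y by move: D'0; rewrite D'E pmulr_rgt0.
have lnD' : ln D' <= ln D - y.
  by rewrite D'E lnM ?posrE// lerD2l// le_ln1Dx// ltrNl opprK; lra.
have eE b : s * (a + b) ^+ 2 / D - ln D / 2
    = (c * a ^+ 2 + c * b ^+ 2 - ln D / 2) + 2 * c * a * b.
  by rewrite /c; field; rewrite gt_eqF.
rewrite (eE p) (eE (- p)) sqrrN mulrN.
set A := _ - ln D / 2; set z := 2 * c * a * p.
have -> : (expR (A + z) + expR (A - z)) / 2
    = expR A * ((expR z + expR (- z)) / 2) by rewrite !expRD; field.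
apply: le_trans (ler_wpM2l (expR_ge0 A) (expR_add_expRN_le z)) _.
rewrite -expRD ler_expR /A /z.
have -> : s * a ^+ 2 / D' = c * a ^+ 2 / (1 - y).
  by rewrite D'E /c; field; rewrite !gt_eqF.
have yy : 1 + y <= (1 - y)^-1.
  rewrite -[leRHS]mul1r ler_pdivlMr//.
  by have := sqr_ge0 y; nra.
have ca0 : 0 <= c * a ^+ 2 by rewrite mulr_ge0// sqr_ge0.
have := ler_wpM2l ca0 yy.
have -> : (2 * c * a * p) ^+ 2 / 2 = c * a ^+ 2 * y by rewrite /y; field.
have -> : c * p ^+ 2 = y / 2 by rewrite /y; field.
by lra.
Qed.

(** A random sign and a standard Gaussian share their first three moments; their fourth moments, 1
    and 3, make the gap exactly [s ^+ 2 * p ^+ 4]. *)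
Lemma lower_potential_avg s a p P :
  (lower_potential s (a + p) P + lower_potential s (a - p) P) / 2
    <= lower_potential s a (P + p ^+ 2).
Proof.
rewrite -subr_ge0 /lower_potential.
set X := (X in 0 <= X); have -> : X = s ^+ 2 * p ^+ 4 by rewrite /X; field.
by rewrite (exprM p 2 2) mulr_ge0// sqr_ge0.
Qed.

Lemma upper_potential_a0 s a : upper_potential s a 0 = expR (s * a ^+ 2).
Proof. by rewrite /upper_potential mulr0 subr0 ln1 mul0r subr0 divr1. Qed.

(** For [x = s * a ^+ 2], the product of [1 - x + x^2/2] and [1 + x + x^2/2] is [1 + x^4/4], and the
    second factor is at most [expR x]. *)
Lemma lower_potential_a0 s a : 0 <= s ->
  expR (- (s * a ^+ 2)) <= lower_potential s a 0.
Proof.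
move=> s0; pose x := s * a ^+ 2.
have x0 : 0 <= x by rewrite mulr_ge0// sqr_ge0.
have -> : lower_potential s a 0 = 1 - x + x ^+ 2 / 2.
  by rewrite /lower_potential /x; field.
rewrite expRN -[leLHS]mul1r ler_pdivrMr ?expR_gt0//.
have e3 := expR_ge_quadratic x0.
have q0 : 0 <= 1 - x + x ^+ 2 / 2 by have := sqr_ge0 (x - 1); lra.
apply: le_trans (ler_wpM2l q0 e3).
have : 0 <= x ^+ 4 by rewrite exprn_ge0.
nra.
Qed.

Lemma lower_potential_a0_ge0 s a : 0 <= lower_potential s a 0.
Proof.
rewrite /lower_potential; have := sqr_ge0 (s * a ^+ 2 - 1).
have -> : (s * a ^+ 2 - 1) ^+ 2 = s ^+ 2 * a ^+ 4 - 2 * s * a ^+ 2 + 1 by ring.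
by lra.
Qed.

Lemma lower_potential_0P_ge0 s P : 0 <= lower_potential s 0 P.
Proof.
rewrite /lower_potential; have := sqr_ge0 (s * P - 1).
have := sqr_ge0 (s * P); rewrite !exprMn !expr0n/=; nra.
Qed.

End SignPotentials.

(** * Sign vectors preserving Euclidean norms *)

(* Method of conditional expectations: the potential is a martingale majorant,
   so at each coordinate one of the two signs does not increase the sum. *)
Lemma exists_signs (K : realFieldType) (E : finType) (D : eqType)
    (Psi : E -> K -> K -> K) (w : E -> K) (L : seq D) (p : E -> D -> K)
    (a : E -> K) :
  uniq L -> (forall e, 0 <= w e) ->
  (forall e, \sum_(d <- L) p e d ^+ 2 <= 1) ->
  (forall e b q P, P + q ^+ 2 <= 1 ->
    (Psi e (b + q) P + Psi e (b - q) P) / 2 <= Psi e b (P + q ^+ 2)) ->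
  exists g : D -> K,
    \sum_e w e * Psi e (a e + \sum_(d <- L) g d * p e d) 0
      <= \sum_e w e * Psi e (a e) (\sum_(d <- L) p e d ^+ 2).
Proof.
move=> + w0 + avg; elim: L a => [|d L IH] a.
  move=> _ _; exists (fun=> 0); rewrite le_eqVlt; apply/orP; left; apply/eqP.
  by apply: eq_bigr => e _; rewrite !big_nil addr0.
move=> /= /andP[dL uL] pE.
have pE' e : \sum_(d <- L) p e d ^+ 2 <= 1.
  by apply: le_trans (pE e); rewrite big_cons lerDr sqr_ge0.
pose S sg := \sum_e w e * Psi e (a e + sg * p e d) (\sum_(d <- L) p e d ^+ 2).
have [sg Ssg] : exists sg, S sg
    <= \sum_e w e * Psi e (a e) (\sum_(d <- d :: L) p e d ^+ 2).
  have S2 : (S 1 + S (-1)) / 2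
      <= \sum_e w e * Psi e (a e) (\sum_(d <- d :: L) p e d ^+ 2).
    rewrite -big_split /= mulr_suml ler_sum// => e _.
    rewrite -mulrDr -mulrA ler_wpM2l// mul1r mulN1r big_cons [p e d ^+ 2 + _]addrC.
    by apply: avg; have := pE e; rewrite big_cons addrC.
  have [S1|/ltW S1] := leP (S 1) (S (-1)).
    by exists 1; apply: le_trans S2; lra.
  by exists (-1); apply: le_trans S2; lra.
have [g gS] := IH (fun e => a e + sg * p e d) uL pE'.
(* Since [d] does not occur in [L], overriding [g] at [d] leaves the sum over [L] intact. *)
exists (fun x => if x == d then sg else g x).
apply: le_trans Ssg; apply: le_trans gS.
rewrite le_eqVlt; apply/orP; left; apply/eqP; apply: eq_bigr => e _.
congr (_ * Psi e _ _); rewrite big_cons eqxx addrA; congr (_ + _).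
by apply: eq_big_seq => x xL; case: eqP xL dL => // -> ->.
Qed.

(** The vectors are chosen one at a time. While one is chosen, the weight holds the factors of those
    already fixed and, as in [w'0], the bound for those still to come. *)
Lemma exists_sign_sequence (K : realFieldType) (E D : finType)
    (Psi : E -> K -> K -> K) (w : E -> K) (p : E -> D -> K) (r : nat) :
  (forall e, 0 <= w e) ->
  (forall e, \sum_d p e d ^+ 2 <= 1) ->
  (forall e b q P, P + q ^+ 2 <= 1 ->
    (Psi e (b + q) P + Psi e (b - q) P) / 2 <= Psi e b (P + q ^+ 2)) ->
  (forall e b, 0 <= Psi e b 0) -> (forall e P, P <= 1 -> 0 <= Psi e 0 P) ->
  exists gs : seq (D -> K), size gs = r /\
    \sum_e w e * \prod_(g <- gs) Psi e (\sum_d g d * p e d) 0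
      <= \sum_e w e * Psi e 0 (\sum_d p e d ^+ 2) ^+ r.
Proof.
move=> + p1 avg Psi0 Psi0'; elim: r w => [|r IH] w w0.
  by exists [::]; split=> //; apply: ler_sum => e _; rewrite big_nil.
have w'0 e : 0 <= w e * Psi e 0 (\sum_d p e d ^+ 2) ^+ r.
  by rewrite mulr_ge0// exprn_ge0// Psi0'.
have [g Hg] := exists_signs (fun=> 0) (index_enum_uniq D) w'0 p1 avg.
have w''0 e : 0 <= w e * Psi e (\sum_d g d * p e d) 0 by rewrite mulr_ge0.
have [gs [szgs Hgs]] := IH _ w''0.
exists (g :: gs); split; first by rewrite /= szgs.
apply: (@le_trans _ _ (\sum_e w e * Psi e (\sum_d g d * p e d) 0
                        * Psi e 0 (\sum_d p e d ^+ 2) ^+ r)).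
  by apply: le_trans Hgs; apply: ler_sum => e _; rewrite big_cons mulrA.
rewrite (eq_bigr (fun e => w e * Psi e 0 (\sum_d p e d ^+ 2) ^+ r
    * Psi e (0 + \sum_d g d * p e d) 0)) => [|e _]; last by rewrite add0r mulrAC.
by apply: le_trans Hg _; apply: ler_sum => e _; rewrite exprSr mulrA.
Qed.

Lemma ln1D_le (K : realType) (x : K) : 0 <= x <= 1 ->
  ln (1 + x) <= x - x ^+ 2 / 4.
Proof.
move=> /andP[x0 x1].
pose y := x - x ^+ 2 / 4.
have y0 : 0 <= y by rewrite /y; nra.
have e3 := expR_ge_quadratic y0.
rewrite -ler_expR lnK ?posrE; last by lra.
apply: le_trans e3; rewrite -subr_ge0.
have -> : 1 + y + y ^+ 2 / 2 - (1 + x) = x ^+ 2 / 4 * (1 - x + x ^+ 2 / 8).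
  by rewrite /y; field.
by rewrite mulr_ge0 ?divr_ge0 ?sqr_ge0//; have := sqr_ge0 x; lra.
Qed.

(** This [s] minimizes the Chernoff exponent [- s * (1 + eps) - ln (1 - 2 * s) / 2] of a squared
    Gaussian; there [1 - 2 * s = (1 + eps)^-1]. The case [P = 0] serves zero vectors, which cannot
    be normalized. *)
Lemma upper_rate (K : realType) (eps P : K) : 0 < eps < 1 -> P = 0 \/ P = 1 ->
  let s := eps / (2 * (1 + eps)) in
  expR (- (s * (P + eps))) * upper_potential s 0 P <= expR (- (eps ^+ 2 / 8)).
Proof.
move=> /andP[e0 e1] P01 /=; set s := eps / _.
have d0 : 0 < 1 + eps by lra.
rewrite /upper_potential expr0n mulr0 mul0r sub0r -expRD ler_expR.
case: P01 => ->.
  rewrite mulr0 subr0 ln1 mul0r oppr0 addr0 add0r lerN2 /s.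
  rewrite [leRHS]mulrAC -expr2 ler_pM2l ?exprn_gt0// lef_pV2 ?posrE ?mulr_gt0//; lra.
have -> : 1 - 2 * s * 1 = (1 + eps)^-1 by rewrite /s; field; rewrite gt_eqF.
have -> : s * (1 + eps) = eps / 2 by rewrite /s; field; rewrite gt_eqF.
rewrite lnV ?posrE//.
have : ln (1 + eps) <= eps - eps ^+ 2 / 4 by apply: ln1D_le; rewrite !ltW.
lra.
Qed.

(** After [1 + z <= expR z], the exponent for [P = 1] is [- s * eps + 3 / 2 * s ^+ 2], minimal at
    [s = eps / 3] with value [- eps ^+ 2 / 6]. *)
Lemma lower_rate (K : realType) (eps P : K) : 0 < eps < 1 -> P = 0 \/ P = 1 ->
  let s := eps / 3 in
  expR (- (s * (eps - P))) * lower_potential s 0 P <= expR (- (eps ^+ 2 / 6)).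
Proof.
move=> /andP[e0 e1] P01 /=.
have : lower_potential (eps / 3) 0 P
    <= expR (- (eps / 3 * P) + eps ^+ 2 / 6 * P ^+ 2).
  apply: le_trans (expR_ge1Dx _); rewrite /lower_potential !expr0n/=; lra.
move=> /(ler_wpM2l (expR_ge0 (- (eps / 3 * (eps - P))))) H.
apply: le_trans H _; rewrite -expRD ler_expR.
have : P ^+ 2 <= 1 by case: P01 => ->; rewrite ?expr0n ?expr1n.
have := sqr_ge0 eps; nra.
Qed.

Section QuadraticConcentration.
Variables (K : realType) (I D : finType) (eps : K) (r : nat).
Hypothesis eps01 : 0 < eps < 1.
Hypothesis rate : #|I|%:R
  * (expR (- (r%:R * eps ^+ 2 / 8)) + expR (- (r%:R * eps ^+ 2 / 6))) < 1.

Let s1 := eps / (2 * (1 + eps)).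
Let s2 := eps / 3.

Let s1_gt0 : 0 < s1.
Proof. by rewrite /s1; case/andP: eps01 => e0 _; rewrite divr_gt0//; lra. Qed.

Let s2_gt0 : 0 < s2.
Proof. by rewrite /s2; case/andP: eps01 => e0 _; rewrite divr_gt0. Qed.

(** A union bound: the two tails of all vectors give nonnegative terms with total below 1, so each
    term is below 1. Each dominates the exponential of a multiple of the excess over its threshold,
    which is therefore negative. *)
Lemma exists_unit_concentration (p : I -> D -> K) :
  (forall i, \sum_d p i d ^+ 2 = 0 \/ \sum_d p i d ^+ 2 = 1) ->
  exists gs : seq (D -> K), size gs = r /\ forall i,
    `|\sum_(g <- gs) (\sum_d g d * p i d) ^+ 2 - r%:R * \sum_d p i d ^+ 2|
      <= r%:R * eps.
Proof.
move=> p01; case/andP: (eps01) => e0 e1.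
pose P i := \sum_d p i d ^+ 2.
have P1 i : P i <= 1 by rewrite /P; case: (p01 i) => ->.
(* The boolean selects the tail, [true] being the upper one. *)
pose Psi (e : I * bool) :=
  if e.2 then @upper_potential K s1 else @lower_potential K s2.
pose c (e : I * bool) :=
  if e.2 then - (s1 * (P e.1 + eps)) else - (s2 * (eps - P e.1)).
pose w e := expR (c e) ^+ r.
have w0 e : 0 <= w e by rewrite exprn_ge0// expR_ge0.
have [||||gs [szgs Hgs]] := @exists_sign_sequence K _ D Psi w (fun e => p e.1) r w0.
- by move=> e; exact: P1.
- move=> [i []] b q Q Q1; rewrite /Psi/=; last exact: lower_potential_avg.
  apply: upper_potential_avg; first exact: ltW.
  have : 2 * s1 < 1.
    by rewrite /s1 mulrA ltr_pdivrMr; lra.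
  by move: s1_gt0; nra.
- move=> [i []] b; rewrite /Psi/=; first exact: expR_ge0.
  exact: lower_potential_a0_ge0.
- move=> [i []] b _; rewrite /Psi/=; first exact: expR_ge0.
  exact: lower_potential_0P_ge0.
exists gs; split=> //.
pose F e := w e * \prod_(g <- gs) Psi e (\sum_d g d * p e.1 d) 0.
have F0 e : 0 <= F e.
  rewrite mulr_ge0// prodr_ge0// => g _; rewrite /Psi; case: e.2.
    exact: expR_ge0.
  exact: lower_potential_a0_ge0.
have sumF : \sum_e F e < 1.
  apply: (le_lt_trans Hgs); apply: le_lt_trans rate.
  rewrite -(pair_bigA _ (fun i b => w (i, b) * Psi (i, b) 0 (P i) ^+ r)) /=.
  rewrite mulr_natl -sumr_const ler_sum// => i _.
  rewrite big_bool /w -!exprMn lerD//.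
    rewrite -mulrA -mulrN expRM_natl.
    by apply: lerXn2r; rewrite ?nnegrE ?mulr_ge0 ?expR_ge0//;
      apply: (upper_rate eps01 (p01 i)).
  rewrite -mulrA -mulrN expRM_natl.
  by apply: lerXn2r; rewrite ?nnegrE ?mulr_ge0 ?expR_ge0 ?lower_potential_0P_ge0//;
    apply: (lower_rate eps01 (p01 i)).
have F1 e : F e < 1.
  by apply: le_lt_trans sumF; rewrite (bigD1 e)//= lerDl sumr_ge0.
move=> i; rewrite ler_norml; apply/andP; split.
  have : expR (r%:R * c (i, false) - s2 * \sum_(g <- gs) (\sum_d g d * p i d) ^+ 2) < 1.
    apply: le_lt_trans (F1 (i, false)).
    rewrite /F /w expRD expRM_natl ler_wpM2l ?exprn_ge0 ?expR_ge0//.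
    rewrite mulr_sumr -sumrN expR_sum ler_prod// => g _.
    by rewrite expR_ge0/= lower_potential_a0// ltW.
  rewrite expR_lt1 /c/= -/(P i); set S := \sum_(g <- gs) _ => H.
  have : s2 * (r%:R * (eps - P i) + S) > 0 by lra.
  by rewrite pmulr_rgt0// => ?; lra.
have : expR (r%:R * c (i, true) + s1 * \sum_(g <- gs) (\sum_d g d * p i d) ^+ 2) < 1.
  apply: le_lt_trans (F1 (i, true)).
  rewrite /F /w expRD expRM_natl ler_wpM2l ?exprn_ge0 ?expR_ge0//.
  rewrite mulr_sumr expR_sum ler_prod// => g _.
  by rewrite expR_ge0/= /Psi/= upper_potential_a0.
rewrite expR_lt1 /c/= -/(P i); set S := \sum_(g <- gs) _ => H.
have : s1 * (r%:R * (P i + eps) - S) > 0 by lra.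
by rewrite pmulr_rgt0// => ?; lra.
Qed.

Lemma exists_concentration (p : I -> D -> K) :
  exists gs : seq (D -> K), size gs = r /\ forall i,
    `|\sum_(g <- gs) (\sum_d g d * p i d) ^+ 2 - r%:R * \sum_d p i d ^+ 2|
      <= r%:R * eps * \sum_d p i d ^+ 2.
Proof.
pose N i := \sum_d p i d ^+ 2.
have N0 i : 0 <= N i by rewrite sumr_ge0// => d _; exact: sqr_ge0.
(* Division by 0 returns 0, so a zero vector stays zero and satisfies the first alternative. *)
pose q i d := p i d / Num.sqrt (N i).
have [i|gs [szgs Hgs]] := @exists_unit_concentration q.
  rewrite /q; under eq_bigr do rewrite expr_div_n sqr_sqrtr//.
  rewrite -mulr_suml -/(N i); have [->|Ni] := eqVneq (N i) 0.
    by left; rewrite mul0r.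
  by right; rewrite divff.
exists gs; split=> // i.
have pq d : p i d = Num.sqrt (N i) * q i d.
  have [Ni|Ni] := eqVneq (N i) 0; last first.
    by rewrite mulrC divfK// sqrtr_eq0 -ltNge lt0r Ni N0.
  rewrite Ni sqrtr0 mul0r; apply/eqP; rewrite -sqrf_eq0.
  by move/eqP: Ni; rewrite /N psumr_eq0 => [/allP/(_ d)|d' _];
    rewrite ?mem_index_enum ?sqr_ge0//; exact.
have := Hgs i => /(ler_wpM2l (N0 i)).
rewrite -{1}(ger0_norm (N0 i)) -normrM [N i * (r%:R * eps)]mulrC -/(N i).
congr (`|_| <= _); rewrite mulrBr; congr (_ - _).
  rewrite mulr_sumr; apply: eq_bigr => g _.
  rewrite -[X in X * _]sqr_sqrtr// -exprMn mulr_sumr; congr (_ ^+ 2).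
  by apply: eq_bigr => d _; rewrite pq mulrCA.
rewrite mulrCA; congr (_ * _); rewrite /N mulr_sumr.
under [RHS]eq_bigr do rewrite pq exprMn sqr_sqrtr//.
by [].
Qed.

End QuadraticConcentration.

(** * Entrywise low-rank approximation of Gram matrices *)

(** With [l = ln (3 * N)], the bound [9 * l <= r * eps ^+ 2] makes the two exponents at least
    [l + l / 8] and [l + l / 2]. The common factor [expR (- l)] reduces the count [N * 2] to 2/3. *)
Lemma failure_sum_lt1 (K : realType) (N r : nat) (eps : K) : (0 < N)%N ->
  0 < eps -> 9 * ln (3 * N)%:R / eps ^+ 2 <= r%:R ->
  (N * 2)%:R * (expR (- (r%:R * eps ^+ 2 / 8))
                + expR (- (r%:R * eps ^+ 2 / 6))) < 1.
Proof.
move=> N0 e0 rN; have N1 : 1 <= N%:R :> K by rewrite ler1n.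
have T0 : 0 < (3 * N)%:R :> K by rewrite ltr0n muln_gt0.
set l := ln _ in rN.
have lE : expR (- l) = (3 * N%:R)^-1 by rewrite expRN /l lnK ?posrE// natrM.
have l3 : expR (- l) <= 3^-1 by rewrite lE lef_pV2 ?posrE; lra.
have re : 9 * l <= r%:R * eps ^+ 2 by rewrite -ler_pdivrMr ?exprn_gt0.
(* 88/100 > 3^(-1/8) and 58/100 > 3^(-1/2), with 2/3 * (88/100 + 58/100) < 1. *)
have H1 : expR (- (l / 8)) <= 88 / 100.
  rewrite -(@ler_pXn2r _ 8) ?nnegrE ?expR_ge0 ?divr_ge0//.
  rewrite -expRM_natl; have -> : 8 * - (l / 8) = - l by field.
  by apply: le_trans l3 _; lra.
have H2 : expR (- (l / 2)) <= 58 / 100.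
  rewrite -(@ler_pXn2r _ 2) ?nnegrE ?expR_ge0 ?divr_ge0//.
  rewrite -expRM_natl; have -> : 2 * - (l / 2) = - l by field.
  by apply: le_trans l3 _; lra.
have E1 : expR (- (r%:R * eps ^+ 2 / 8)) <= expR (- l) * (88 / 100).
  apply: le_trans (ler_wpM2l (expR_ge0 _) H1).
  by rewrite -expRD ler_expR; lra.
have E2 : expR (- (r%:R * eps ^+ 2 / 6)) <= expR (- l) * (58 / 100).
  apply: le_trans (ler_wpM2l (expR_ge0 _) H2).
  by rewrite -expRD ler_expR; lra.
apply: (@le_lt_trans _ _ ((N * 2)%:R * (expR (- l) * (146 / 100)))).
  by rewrite ler_wpM2l//; lra.
rewrite lE natrM.
have -> : N%:R * 2 * ((3 * N%:R)^-1 * (146 / 100)) = 292 / 300 :> K.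
  by field; lra.
lra.
Qed.

(** For the vectors [(u_i +- v_j) / 2], the squared norms differ by the inner product and add up to
    at most [alpha], so the two relative errors total at most [eps * alpha]. [B] factors through the
    [r] sign vectors. *)
Lemma exists_low_rank_gram (K : realType) (D : finType) (n1 n2 r : nat)
    (u : 'I_n1 -> D -> K) (v : 'I_n2 -> D -> K) (alpha eps : K) :
  (0 < n1)%N -> (0 < n2)%N -> 0 < eps < 1 ->
  9 * ln (3 * n1 * n2)%:R / eps ^+ 2 <= r%:R ->
  (forall i, \sum_d u i d ^+ 2 <= alpha) ->
  (forall j, \sum_d v j d ^+ 2 <= alpha) ->
  exists B : 'M[K]_(n1, n2), (\rank B <= r)%N /\
    forall i j, `|\sum_d u i d * v j d - B i j| <= eps * alpha.
Proof.
move=> n10 n20 eps01 rE ua va; have /andP[e0 e1] := eps01.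
(* The factor 3 keeps the logarithm positive even when [n1 = n2 = 1], so dividing by [r] is
   legitimate. *)
have r0 : 0 < r%:R :> K.
  apply: lt_le_trans rE; rewrite divr_gt0 ?exprn_gt0// mulr_gt0// ln_gt0//.
  by rewrite ltr1n (@leq_trans (3 * 1 * 1))// !leq_mul.
pose p (k : 'I_n1 * 'I_n2 * bool) d :=
  (u k.1.1 d + (if k.2 then v k.1.2 d else - v k.1.2 d)) / 2.
have rate : #|{: 'I_n1 * 'I_n2 * bool}|%:R
  * (expR (- (r%:R * eps ^+ 2 / 8)) + expR (- (r%:R * eps ^+ 2 / 6))) < 1.
  rewrite !card_prod !card_ord card_bool; apply: failure_sum_lt1 => //.
    by rewrite muln_gt0 n10.
  by rewrite mulnA.
have [gs [szgs Hgs]] := exists_concentration eps01 rate p.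
pose ip (g : D -> K) (x : D -> K) := \sum_d g d * x d.
pose X : 'M[K]_(n1, r) := \matrix_(i, k) (r%:R^-1 * ip (nth (fun=> 0) gs k) (u i)).
pose Y : 'M[K]_(r, n2) := \matrix_(k, j) ip (nth (fun=> 0) gs k) (v j).
exists (X *m Y); split; first exact: mulmx_max_rank.
move=> i j.
have BE : r%:R * (X *m Y) i j = \sum_(g <- gs) ip g (u i) * ip g (v j).
  rewrite (big_nth (fun=> 0)) szgs big_mkord mxE mulr_sumr.
  by apply: eq_bigr => k _; rewrite !mxE -mulrA mulVKf// gt_eqF.
pose Q b := \sum_(g <- gs) (\sum_d g d * p (i, j, b) d) ^+ 2.
pose N b := \sum_d p (i, j, b) d ^+ 2.
have QE : Q true - Q false = \sum_(g <- gs) ip g (u i) * ip g (v j).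
  rewrite /Q -sumrB; apply: eq_bigr => g _.
  have ipE b : \sum_d g d * p (i, j, b) d
      = (ip g (u i) + (if b then ip g (v j) else - ip g (v j))) / 2.
    rewrite /ip /p; case: b => /=; rewrite -?sumrN -big_split /= mulr_suml;
      by apply: eq_bigr => d _; field.
  by rewrite !ipE; field.
have ND : N true - N false = \sum_d u i d * v j d.
  by rewrite /N -sumrB; apply: eq_bigr => d _; rewrite /p/=; field.
have NS : N true + N false <= alpha.
  have -> : N true + N false = (\sum_d u i d ^+ 2 + \sum_d v j d ^+ 2) / 2.
    rewrite /N -!big_split /= mulr_suml.
    by apply: eq_bigr => d _; rewrite /p/=; field.
  by have := ua i; have := va j; lra.
have := Hgs (i, j, true); have := Hgs (i, j, false).
rewrite -/(Q true) -/(Q false) -/(N true) -/(N false) => Hf Ht.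
rewrite -(ler_pM2l r0) -{1}(ger0_norm (ltW r0)) -normrM mulrBr BE -ND -QE.
have -> : r%:R * (N true - N false) - (Q true - Q false)
  = (Q false - r%:R * N false) - (Q true - r%:R * N true) by ring.
apply: le_trans (ler_normB _ _) _.
apply: le_trans (lerD Hf Ht) _.
by rewrite -mulrDr addrC -mulrA !ler_wpM2l// ltW.
Qed.

(** Tensor powers are indexed by functions from ['I_s] to [D]; distributivity gives their inner
    products. The rank bound for Gram matrices does not depend on the dimension, so the growth of
    the index set costs nothing. *)
Lemma exists_low_rank_power (K : realType) (D : finType) (n1 n2 r s : nat)
    (u : 'I_n1 -> D -> K) (v : 'I_n2 -> D -> K) (alpha eps : K) :
  (0 < n1)%N -> (0 < n2)%N -> 0 < eps < 1 ->
  9 * ln (3 * n1 * n2)%:R / eps ^+ 2 <= r%:R ->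
  (forall i, \sum_d u i d ^+ 2 <= alpha) ->
  (forall j, \sum_d v j d ^+ 2 <= alpha) ->
  exists B : 'M[K]_(n1, n2), (\rank B <= r)%N /\
    forall i j, `|(\sum_d u i d * v j d) ^+ s - B i j| <= eps * alpha ^+ s.
Proof.
move=> n10 n20 eps01 rE ua va.
pose tens (x : D -> K) (f : {ffun 'I_s -> D}) := \prod_k x (f k).
have tensE x y : \sum_f tens x f * tens y f = (\sum_d x d * y d) ^+ s.
  have -> : (\sum_d x d * y d) ^+ s = \prod_(k < s) \sum_d x d * y d.
    by rewrite prodr_const card_ord.
  rewrite (bigA_distr_bigA (fun (_ : 'I_s) d => x d * y d)).
  by apply: eq_bigr => f _; rewrite big_split.
have tens2 x : \sum_d x d ^+ 2 <= alpha -> \sum_f tens x f ^+ 2 <= alpha ^+ s.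
  move=> xa; under eq_bigr do rewrite expr2.
  rewrite tensE; under eq_bigr do rewrite -expr2.
  by apply: lerXn2r => //; rewrite nnegrE ?(le_trans _ xa)// sumr_ge0// => d _;
    exact: sqr_ge0.
have [B [rB HB]] := exists_low_rank_gram n10 n20 eps01 rE
  (fun i => tens2 _ (ua i)) (fun j => tens2 _ (va j)).
by exists B; split=> // i j; rewrite -tensE.
Qed.

(** * Taylor expansion with derivatives taken within a set *)

Section TaylorWithin.
Variable K : realType.
Implicit Types (Omega : set K) (f : K -> K) (x b : K).

Lemma is_derive_within_interior Omega f x : nbhs x Omega ->
  derivable_within Omega f x -> is_derive x 1 f (derive_within Omega f x).
Proof.
move=> Ox fl.
have shift : (h *: 1 + x : K) @[h --> 0^'] --> within Omega x^'.
  move=> A [e /= e0 Ae]; have [d /= d0 Od] := Ox.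
  exists (Num.min e d) => /=; first by rewrite lt_min e0.
  move=> h /=; rewrite sub0r normrN lt_min => /andP[he hd] h0.
  have xh : x - (h *: 1 + x) = - h by rewrite [_ *: _]mulr1; ring.
  apply: Ae; rewrite /ball_ /= ?xh ?normrN//.
    by rewrite -subr_eq0 addrK [_ *: _]mulr1.
  by apply: Od; rewrite /ball_ /= xh normrN.
have dq : h^-1 *: (f (h *: 1 + x) - f x) @[h --> 0^'] -->
    derive_within Omega f x.
  have := cvg_comp _ _ shift fl; apply: cvg_trans.
  apply: near_eq_cvg; near=> h => /=.
  by rewrite /= addrK (_ : h *: 1 = h) ?[h *: 1]mulr1//; exact: mulrC.
apply: DeriveDef; first by apply/cvg_ex; eexists; exact: dq.
exact: cvg_lim dq.
Unshelve. all: by end_near. Qed.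

(** Away from [x], [f y] is the difference quotient times [y - x], plus [f x]. This covers
    endpoints, where the derivative is one-sided. *)
Lemma derivable_within_continuous Omega f (A : set K) : A `<=` Omega ->
  (forall x, A x -> derivable_within Omega f x) -> {within A, continuous f}.
Proof.
move=> AO df; apply/subspace_continuousP => x Ax.
have idx : (y - x : K) @[y --> within Omega x^'] --> (0 : K).
  rewrite -(subrr x); apply: cvgB; last exact: cvg_cst.
  move=> V Vx; apply: cvg_within; exact: cvg_within.
have := cvgD (cvgM (df x Ax) idx) (cvg_cst (f x)).
rewrite mulr0 add0r => fx V Vfx.
have H : \forall y \near x, y != x -> Omega y ->
    V ((f y - f x) / (y - x) * (y - x) + f x).
  exact: (fx _ _ _ V Vfx).
have : \forall y \near x, A y -> V (f y); last by [].
apply: filterS H => y H Ay; have [->|yx] := eqVneq y x; first exact: nbhs_singleton.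
have := H yx (AO y Ay); rewrite divfK ?subrK// subr_eq0//.
Qed.

Lemma is_derive_monomial (c : K) (n : nat) (y : K) :
  is_derive y 1 (fun z => c * (z ^+ n.+1 / n.+1`!%:R)) (c * (y ^+ n / n`!%:R)).
Proof.
have -> : (fun z => c * (z ^+ n.+1 / n.+1`!%:R))
    = (c / n.+1`!%:R) \*: (id ^+ n.+1 : K -> K).
  by apply/funext => z; rewrite fctE /= [RHS]mulrAC -mulrA.
apply: is_derive_eq.
rewrite /= factS natrM -!/(_ * _) /GRing.scale/=. field.
by rewrite nat1r !pnatr_eq0 -lt0n fact_gt0.
Qed.

Lemma is_derive_taylor_sum (a : nat -> K) (n : nat) (y : K) :
  is_derive y 1 (fun z => \sum_(s < n.+1) a s * (z ^+ s / s`!%:R))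
    (\sum_(s < n) a s.+1 * (y ^+ s / s`!%:R)).
Proof.
elim: n => [|n IH].
  rewrite big_ord0.
  have -> : (fun z => \sum_(s < 1) a s * (z ^+ s / s`!%:R)) = cst (a 0%N).
    by apply/funext => z; rewrite big_ord1 expr0 fact0 divr1 mulr1.
  exact: is_derive_cst.
rewrite [X in is_derive _ _ _ X]big_ord_recr /=.
have -> : (fun z => \sum_(s < n.+2) a s * (z ^+ s / s`!%:R))
  = (fun z => \sum_(s < n.+1) a s * (z ^+ s / s`!%:R))
    + (fun z => a n.+1 * (z ^+ n.+1 / n.+1`!%:R)).
  by apply/funext => z; rewrite fctE big_ord_recr.
by apply: is_deriveD; exact: is_derive_monomial.
Qed.

(** Here [f s] stands for the [s]-th derivative, so that the induction on [n] merely shifts [f]. The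
    induction hypothesis bounds the derivative of the remainder, and monotonicity integrates that
    bound from 0; differentiability is asked only in the open interval. *)
Lemma taylor_remainder_le (f : nat -> K -> K) (n : nat) b (B : K) :
  (forall s, {within `[0, b], continuous (f s)}) ->
  (forall s x, x \in `]0, b[%R -> is_derive x 1 (f s) (f s.+1 x)) ->
  (forall x, x \in `[0, b]%R -> `|f n x| <= B) ->
  forall x, x \in `[0, b]%R ->
  `|f 0%N x - \sum_(s < n) f s 0 * (x ^+ s / s`!%:R)| <= B * (x ^+ n / n`!%:R).
Proof.
elim: n f => [|n IH] f fc fd fB x xb.
  by rewrite big_ord0 subr0 expr0 fact0 divr1 mulr1 fB.
have {}IH (y : K) : y \in `[0, b]%R ->
    `|f 1%N y - \sum_(s < n) f s.+1 0 * (y ^+ s / s`!%:R)|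
    <= B * (y ^+ n / n`!%:R).
  exact: (IH (fun s => f s.+1) (fun s => fc s.+1) (fun s => fd s.+1) fB y).
pose T y := \sum_(s < n.+1) f s 0 * (y ^+ s / s`!%:R).
pose T' y := \sum_(s < n) f s.+1 0 * (y ^+ s / s`!%:R).
have dT (y : K) : is_derive y 1 T (T' y).
  by exact: (is_derive_taylor_sum (fun s => f s 0)).
have cT : continuous T.
  by move=> y; apply: differentiable_continuous; apply/derivable1_diffP.
pose U y := B * (y ^+ n.+1 / n.+1`!%:R).
pose U' y := B * (y ^+ n / n`!%:R).
have dU (y : K) : is_derive y 1 U (U' y) by exact: is_derive_monomial.
have cU : continuous U.
  by move=> y; apply: differentiable_continuous; apply/derivable1_diffP.
(* Taking [sg] to be 1 and -1 gives the two sides of the absolute value. *)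
have mono (sg : K) : `|sg| = 1 -> 0 <= U x - sg * (f 0%N x - T x).
  move=> sg1.
  pose g y := U y - sg * (f 0%N y - T y).
  have g0 : g 0 = 0.
    rewrite /g /U /T expr0n mul0r mulr0 sub0r big_ord_recl expr0 fact0 divr1 mulr1.
    rewrite big1 => [|i _]; last by rewrite expr0n mul0r mulr0.
    by rewrite addr0 subrr mulr0 oppr0.
  rewrite -/(g x) -g0.
  have dg (y : K) : y \in `]0, b[%R -> is_derive y 1 g (U' y - sg * (f 1%N y - T' y)).
    move=> yb; have := fd 0%N y yb => fdy.
    exact: (is_deriveB (dU y) (is_deriveZ sg (is_deriveB fdy (dT y)))).
  apply: (@ger0_derive1_le_cc _ g 0 b).
  - by move=> y yb; have [] := dg y yb.
  - move=> y yb; rewrite derive1E; have [_ ->] := dg y yb.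
    have yb' : y \in `[0, b]%R by apply: subset_itv_oo_cc.
    rewrite subr_ge0 (le_trans (ler_norm _))// normrM sg1 mul1r.
    exact: IH.
  - move=> z; apply: continuousB; first exact: continuous_subspaceT.
    apply: continuousM; first exact: cvg_cst.
    apply: continuousB; first exact: fc.
    exact: continuous_subspaceT.
  - by rewrite in_itv/= lexx; move: xb; rewrite in_itv/= => /andP[]; exact: le_trans.
  - by [].
  - by move: xb; rewrite in_itv/= => /andP[].
rewrite ler_norml -/(T x) -/(U x).
have := mono 1 (normr1 _); have := mono (-1) (normrN1 _).
by lra.
Qed.

Lemma taylor_within_le Omega f (C M b : K) (n : nat) :
  `[0, b] `<=` Omega -> smooth_on Omega f ->
  (forall s, sup_norm_on Omega (nderive_within Omega s f) <= (C * M ^+ s)%:E)%E ->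
  forall z, z \in `[0, b]%R ->
  `|f z - \sum_(s < n) nderive_within Omega s f 0 * (z ^+ s / s`!%:R)|
    <= C * M ^+ n * (z ^+ n / n`!%:R).
Proof.
move=> bO smf fM.
apply: (@taylor_remainder_le (fun s => nderive_within Omega s f)).
- by move=> s; apply: (derivable_within_continuous bO) => x /bO; exact: smf.
- move=> s x xb; apply: is_derive_within_interior.
    apply: filterS bO _; apply: filterS (@subset_itv_oo_cc _ _ 0 b) _.
    exact: near_in_itvoo.
  by apply: smf; apply: bO; exact: (@subset_itv_oo_cc _ _ 0 b).
- move=> x xb; rewrite -lee_fin; apply: le_trans (fM n).
  by apply: ereal_sup_ubound; exists x => //; exact: bO.
Qed.

End TaylorWithin.

(** * The quadratic form of a positive-definite matrix *)

Section QuadraticForm.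
Variables (K : realType) (m : nat) (W : 'M[K]_m).
Hypotheses (m0 : (0 < m)%N) (posW : sym_posdef W).
Implicit Types x y : 'cV[K]_m.

Let sq x := \sum_(i < m) x i 0 ^+ 2.
Let q x : K := (x^T *m W *m x) 0 0.

Let sq_ge0 x : 0 <= sq x.
Proof. by rewrite sumr_ge0// => i _; exact: sqr_ge0. Qed.

Let qE x : q x = \sum_i x i 0 * (W *m x) i 0.
Proof. by rewrite /q -mulmxA mxE; apply: eq_bigr => i _; rewrite !mxE. Qed.

Let q_gt0 x : x != 0 -> 0 < q x.
Proof. exact: (proj2 posW). Qed.

Let q_ge0 x : 0 <= q x.
Proof.
by have [->|/q_gt0/ltW//] := eqVneq x 0; rewrite /q mulmx0 mxE.
Qed.

Lemma euclid_norm_le x (r : K) : 0 <= r ->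
  (euclid_norm x <= r) = (\sum_(i < m) x i 0 ^+ 2 <= r ^+ 2).
Proof.
move=> r0; rewrite -(@ler_pXn2r _ 2) ?nnegrE ?sqrtr_ge0//.
by rewrite sqr_sqrtr// sq_ge0.
Qed.

Lemma euclid_normZ (c : K) x : 0 <= c -> euclid_norm (c *: x) = c * euclid_norm x.
Proof.
move=> c0; rewrite /euclid_norm.
under eq_bigr do rewrite mxE exprMn.
by rewrite -mulr_sumr sqrtrM ?sqr_ge0// sqrtr_sqr ger0_norm.
Qed.

(** The real [sup] is meaningful only on a nonempty bounded set. On the unit ball every coordinate
    is at most 1 in absolute value, so absolute row sums bound the image. *)
Lemma spectral_norm_has_sup :
  has_sup [set euclid_norm (W *m x) | x in [set x | euclid_norm x <= 1]].
Proof.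
split.
  exists (euclid_norm (W *m 0)); exists 0 => //=.
  by rewrite euclid_norm_le// big1 ?ler01// => i _; rewrite mxE expr0n.
pose B := \sum_(i < m) (\sum_(j < m) `|W i j|) ^+ 2.
have B0 : 0 <= B by rewrite sumr_ge0// => i _; exact: sqr_ge0.
exists (Num.sqrt B) => _ [x /= x1 <-].
rewrite euclid_norm_le ?sqrtr_ge0// sqr_sqrtr//; apply: ler_sum => i _.
rewrite -real_normK ?num_real// lerXn2r ?nnegrE ?sumr_ge0//.
rewrite mxE (le_trans (ler_norm_sum _ _ _))//; apply: ler_sum => j _.
rewrite normrM ler_piMr// -(@ler_pXn2r _ 2) ?nnegrE// real_normK ?num_real//.
move: x1; rewrite euclid_norm_le//; apply: le_trans.
by rewrite (bigD1 j)//= lerDl sumr_ge0// => k _; exact: sqr_ge0.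
Qed.

Lemma euclid_norm_mulmx_le x :
  euclid_norm (W *m x) <= spectral_norm W * euclid_norm x.
Proof.
have n0 : 0 <= euclid_norm x by exact: sqrtr_ge0.
have [nx|nx] := eqVneq (euclid_norm x) 0.
  have -> : x = 0.
    apply/matrixP => i j; rewrite ord1 mxE; apply/eqP; rewrite -sqrf_eq0.
    have : sq x == 0 by rewrite eq_le sq_ge0 andbT -sqrtr_eq0 -/(euclid_norm x) nx.
    rewrite psumr_eq0 => [/allP/(_ i)|k _]; last exact: sqr_ge0.
    by rewrite mem_index_enum; exact.
  by rewrite mulmx0 -(scale0r 0) !euclid_normZ// !mul0r mulr0.
have n_gt0 : 0 < euclid_norm x by rewrite lt0r nx.
rewrite -ler_pdivrMr// mulrC -euclid_normZ ?invr_ge0// scalemxAr.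
apply: (sup_upper_bound spectral_norm_has_sup); eexists; last reflexivity.
by rewrite /= euclid_normZ ?invr_ge0// mulVf.
Qed.

(** Otherwise [W] would annihilate the all-ones vector, which is nonzero as [0 < m]. Positivity
    allows division by the norm and by its square root. *)
Lemma spectral_norm_gt0 : 0 < spectral_norm W.
Proof.
rewrite ltNge; apply/negP => S0.
pose x : 'cV[K]_m := const_mx 1.
have x0 : x != 0.
  apply/eqP => /matrixP/(_ (Ordinal m0) 0); rewrite !mxE => /eqP.
  by rewrite oner_eq0.
have : euclid_norm (W *m x) <= 0.
  apply: le_trans (euclid_norm_mulmx_le x) _.
  by rewrite mulr_le0_ge0// sqrtr_ge0.
rewrite euclid_norm_le// expr0n /= => Wx.
have Wx0 i : (W *m x) i 0 = 0.
  apply/eqP; rewrite -sqrf_eq0 eq_le sqr_ge0 andbT; apply: le_trans Wx.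
  by rewrite (bigD1 i)//= lerDl sumr_ge0// => k _; exact: sqr_ge0.
by have := q_gt0 x0; rewrite qE big1 ?ltxx// => i _; rewrite Wx0 mulr0.
Qed.

Lemma sum_sqr_mulmx_le x :
  \sum_i (W *m x) i 0 ^+ 2 <= spectral_norm W ^+ 2 * \sum_i x i 0 ^+ 2.
Proof.
have S0 := ltW spectral_norm_gt0.
have := euclid_norm_mulmx_le x.
rewrite euclid_norm_le ?mulr_ge0 ?sqrtr_ge0// exprMn sqr_sqrtr//.
exact: sq_ge0.
Qed.

Lemma wnorm_sqr x : wnorm W x ^+ 2 = (x^T *m W *m x) 0 0.
Proof. by rewrite sqr_sqrtr// q_ge0. Qed.

(** Weighted AM-GM, [2ab <= S a^2 + b^2 / S], replaces Cauchy-Schwarz; the weight [S] makes the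
    bounds on both halves equal. *)
Lemma wnorm_sqr_le x :
  wnorm W x ^+ 2 <= spectral_norm W * \sum_i x i 0 ^+ 2.
Proof.
have S0 := spectral_norm_gt0; set S := spectral_norm W in S0 *.
rewrite wnorm_sqr -/(q x) qE.
apply: (@le_trans _ _
    (\sum_i (S * x i 0 ^+ 2 + S^-1 * (W *m x) i 0 ^+ 2) / 2)).
  apply: ler_sum => i _; set a := x i 0; set b := (W *m x) i 0.
  have := sqr_ge0 (S * a - b) => /(mulr_ge0 (ltW (_ : 0 < S^-1))).
  rewrite invr_gt0 => /(_ S0).
  have -> : S^-1 * (S * a - b) ^+ 2 = S * a ^+ 2 + S^-1 * b ^+ 2 - 2 * (a * b).
    by field; rewrite gt_eqF.
  lra.
rewrite -mulr_suml big_split /= -!mulr_sumr.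
have := sum_sqr_mulmx_le x; rewrite -/S => /(ler_wpM2l (ltW (_ : 0 < S^-1))).
rewrite invr_gt0 => /(_ S0); rewrite mulrA expr2 mulKf ?gt_eqF//.
lra.
Qed.

Lemma wnorm_sqrB x y : wnorm W (x - y) ^+ 2
  = wnorm W x ^+ 2 + wnorm W y ^+ 2 - 2 * \sum_i (W *m x) i 0 * y i 0.
Proof.
rewrite !wnorm_sqr -!/(q _).
have yWx : (y^T *m W *m x) 0 0 = \sum_i (W *m x) i 0 * y i 0.
  by rewrite -mulmxA mxE; apply: eq_bigr => i _; rewrite !mxE mulrC.
have xWy : (x^T *m W *m y) 0 0 = (y^T *m W *m x) 0 0.
  have -> : (x^T *m W *m y) 0 0 = (x^T *m W *m y)^T 0 0 by rewrite [RHS]mxE.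
  by rewrite !trmx_mul trmxK (proj1 posW) mulmxA.
have mxB (A B : 'M[K]_1) : (A - B) 0 0 = A 0 0 - B 0 0 by rewrite !mxE.
rewrite /q [(x - y)^T]linearB /= !(mulmxBl, mulmxBr) !mxB xWy yWx; ring.
Qed.

(* [W x] and [y], rather than a square root of [W], carry the cross term. *)
Lemma exists_gram_wnorm (R : K) : 0 < R -> exists (D : finType)
    (u v : 'cV[K]_m -> D -> K),
  (forall x, \sum_i x i 0 ^+ 2 <= R ^+ 2 ->
    \sum_d u x d ^+ 2 <= 4 * spectral_norm W * R ^+ 2 /\
    \sum_d v x d ^+ 2 <= 4 * spectral_norm W * R ^+ 2) /\
  (forall x y, \sum_d u x d * v y d = wnorm W (x - y) ^+ 2).
Proof.
move=> R0; have S0 := spectral_norm_gt0; set S := spectral_norm W in S0 *.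
pose c := Num.sqrt S.
have c0 : 0 < c by rewrite sqrtr_gt0.
have cS : c ^+ 2 = S by rewrite sqr_sqrtr// ltW.
have cRS : (c * R) ^+ 2 = S * R ^+ 2 by rewrite exprMn cS.
(* The [inl] coordinates produce the two squared norms; doubling the others supplies the factor 2 of
   the cross term. With the scale [c * R], two single coordinates and two copies of a vector each
   contribute at most [S * R ^+ 2], hence the constant 4. *)
pose u x (d : bool + 'I_m * bool) := match d with
  | inl true => wnorm W x ^+ 2 / (c * R) | inl false => c * R
  | inr (k, _) => (W *m x) k 0 / c end.
pose v x (d : bool + 'I_m * bool) := match d with
  | inl false => wnorm W x ^+ 2 / (c * R) | inl true => c * R
  | inr (k, _) => - (c * x k 0) end.
have sumD (F : bool + 'I_m * bool -> K) :
    \sum_d F d = F (inl true) + F (inl false)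
      + \sum_k (F (inr (k, true)) + F (inr (k, false))).
  rewrite big_sumType big_bool /=; congr (_ + _).
  rewrite (eq_bigr (fun p => F (inr (p.1, p.2)))); last by case.
  rewrite -(pair_bigA _ (fun k b => F (inr (k, b)))) /=.
  by apply: eq_bigr => k _; rewrite big_bool.
exists (bool + 'I_m * bool)%type, u, v; split=> [x xR|x y].
  have w2 : (wnorm W x ^+ 2 / (c * R)) ^+ 2 <= S * R ^+ 2.
    rewrite -cRS.
    have cR0 : 0 < c * R by rewrite mulr_gt0.
    apply: lerXn2r; rewrite ?nnegrE ?divr_ge0 ?sqr_ge0 ?(ltW cR0)//.
    rewrite ler_pdivrMr// -expr2 cRS.
    by rewrite (le_trans (wnorm_sqr_le x))// ler_wpM2l// ltW.
  rewrite !sumD /u /v /=; split.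
    have uE k : ((W *m x) k 0 / c) ^+ 2 = (W *m x) k 0 ^+ 2 / S.
      by rewrite -cS expr_div_n.
    under eq_bigr do rewrite !uE.
    rewrite big_split /= -!mulr_suml cRS.
    have : (\sum_k (W *m x) k 0 ^+ 2) / S <= S * R ^+ 2.
      rewrite ler_pdivrMr// (_ : S * _ * S = S ^+ 2 * R ^+ 2); last by ring.
      exact: le_trans (sum_sqr_mulmx_le x) (ler_wpM2l (sqr_ge0 S) xR).
    by move=> ?; lra.
  have vE k : (- (c * x k 0)) ^+ 2 = S * x k 0 ^+ 2 by rewrite -cS; ring.
  under eq_bigr do rewrite !vE.
  rewrite big_split /= -!mulr_sumr cRS.
  have := ler_wpM2l (ltW S0) xR => ?; lra.
rewrite sumD /u /v /= wnorm_sqrB divfK ?gt_eqF ?mulr_gt0//.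
rewrite [c * R * _]mulrC divfK ?gt_eqF ?mulr_gt0//; congr (_ + _).
rewrite big_split /= mulr_sumr -sumrN -big_split /=; apply: eq_bigr => k _.
by field; rewrite gt_eqF.
Qed.

End QuadraticForm.

(** * Assembling the approximation *)

(** One term of the exponential series gives [n^n / n! <= e^n], while the hypothesis gives
    [y^n <= e^(-2n) n^n]. This is the source of [e^2] in the condition on [t]. *)
Lemma pow_fact_le (K : realType) (y : K) (n : nat) : 0 <= y ->
  expR 1 ^+ 2 * y <= n%:R -> y ^+ n / n`!%:R <= expR (- n%:R).
Proof.
move=> y0 yn.
have f0 : 0 < n`!%:R :> K by rewrite ltr0n fact_gt0.
have e0 : 0 < expR 1 :> K by exact: expR_gt0.
have nn : n%:R ^+ n / n`!%:R <= expR n%:R :> K.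
  apply: le_trans (expR_ge_partial_sum n.+1 (ler0n K n)).
  rewrite big_ord_recr /= lerDr sumr_ge0//.
have yn' : (expR 1 ^+ 2 * y) ^+ n <= n%:R ^+ n.
  by apply: lerXn2r; rewrite ?nnegrE// mulr_ge0// exprn_ge0// ltW.
have eE : expR 1 ^+ 2 ^+ n = expR n%:R * expR n%:R :> K.
  by rewrite -exprM -expRM_natl mulr1 -expRD mul2n -addnn natrD.
rewrite expRN -[leRHS]mul1r ler_pdivlMr ?expR_gt0//.
rewrite -(ler_pM2r (expR_gt0 n%:R)) mul1r.
apply: le_trans nn; rewrite ler_pdivlMr//.
apply: le_trans yn'; rewrite exprMn eE.
by rewrite le_eqVlt; apply/orP; left; apply/eqP; field; rewrite gt_eqF.
Qed.

Lemma exp_tail_sum_le (K : realType) (y : K) (n : nat) : 0 <= y ->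
  \sum_(s < n) y ^+ s.+1 / s.+1`!%:R <= expR y - 1.
Proof.
move=> y0; have := expR_ge_partial_sum n.+1 y0.
rewrite big_ord_recl /= expr0 fact0 divr1 => H.
by rewrite lerBrDl.
Qed.

Lemma mxrank_sum_le (F : fieldType) (m n k r : nat) (A : 'I_k -> 'M[F]_(m, n)) :
  (forall i, \rank (A i) <= r)%N -> (\rank (\sum_i A i)%R <= k * r)%N.
Proof.
elim: k A => [|k IH] A Ar; first by rewrite big_ord0 mxrank0.
rewrite big_ord_recr /= mulSn addnC.
by apply: leq_trans (mxrank_add _ _) _; rewrite leq_add// IH.
Qed.

Lemma mxrank_const_le1 (F : fieldType) (m n : nat) (a : F) :
  (\rank (const_mx a : 'M[F]_(m, n)) <= 1)%N.
Proof.
have -> : const_mx a = (const_mx a : 'M[F]_(m, 1)) *m (const_mx 1 : 'M[F]_(1, n)).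
  by apply/matrixP => i j; rewrite !mxE big_ord1 !mxE mulr1.
exact: mulmx_max_rank.
Qed.

Lemma mx_norm_le (K : realType) (m n : nat) (A : 'M[K]_(m, n)) (c : K) :
  0 <= c -> (forall i j, `|A i j| <= c) -> mx_norm A <= c.
Proof.
move=> c0 Ac; have [->//|/mx_norm_neq0[[i j] /= ->]] := eqVneq (mx_norm A) 0.
exact: Ac.
Qed.

Theorem theorem4p2 (K : realType) (eps : K) (n1 n2 : nat) (r : int)
    (sigma R : K) (Omega : set K) (h : K -> K) (C M : K)
    (m : nat) (W : 'M[K]_m) :
  0 < eps < 1 ->
  (0 < n1)%N -> (0 < n2)%N ->
  r = Num.ceil (9 * ln ((3 * n1 * n2)%N%:R : K) / eps ^+ 2) ->
  0 < sigma -> 0 < R ->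
  is_interval Omega ->
  `[- (4 * sigma * R ^+ 2), 4 * sigma * R ^+ 2] `<=` Omega ->
  [bounded h u | u in Omega] ->
  smooth_on Omega h ->
  0 <= C -> 0 < M ->
  (forall s : nat,
    (sup_norm_on Omega (nderive_within Omega s h) <= (C * M ^+ s)%:E)%E) ->
  (0 < m)%N ->
  sym_posdef W ->
  spectral_norm W <= sigma ->
  forall (F : 'M[K]_(n1, n2)) (x : 'I_n1 -> 'cV[K]_m) (y : 'I_n2 -> 'cV[K]_m),
  (forall i, euclid_norm (x i) <= R) ->
  (forall j, euclid_norm (y j) <= R) ->
  (forall i j, F i j = h (wnorm W (x i - y j) ^+ 2)) ->
  forall t : int,
  4 * expR 1 ^+ 2 * M * spectral_norm W * R ^+ 2 <= t%:~R ->
  exists G : 'M[K]_(n1, n2),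
    (\rank G)%:Z <= 1 + (t - 1) * r /\
    mx_norm (F - G) <=
      C * (expR (- t%:~R) +
           eps * (expR (4 * M * spectral_norm W * R ^+ 2) - 1)).
Proof.
move=> eps01 n10 n20 rE sigma0 R0 _ itvO _ smh C0 M0 hM m0 posW Ssigma F x y xR yR FE
  t tE.
have S0 := spectral_norm_gt0 m0 posW; set S := spectral_norm W in S0 Ssigma tE *.
pose rho := 4 * S * R ^+ 2.
have rho0 : 0 < rho by rewrite !mulr_gt0// exprn_gt0.
have tE' : expR 1 ^+ 2 * (M * rho) <= t%:~R.
  by move: tE; rewrite /rho; congr (_ <= _); ring.
have -> : 4 * M * S * R ^+ 2 = M * rho by rewrite /rho; ring.
have Mrho0 : 0 < M * rho by rewrite mulr_gt0.
have t0 : (0 < t)%R.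
  by rewrite -(ltr0z K); apply: lt_le_trans tE'; rewrite mulr_gt0// exprn_gt0// expR_gt0.
(* Writing [t] as [k.+1], the Taylor polynomial has degree [k], hence [t - 1] nonconstant terms. *)
case: t t0 tE tE' => [[//|k]|//] _ _ tE'.
have e0 : 0 < eps by case/andP: eps01.
set L := 9 * _ / _ in rE.
have L0 : 0 <= L.
  rewrite divr_ge0 ?exprn_ge0 ?(ltW e0)// mulr_ge0// ln_ge0// ler1n.
  by rewrite !muln_gt0 n10.
have r0 : 0 <= r by rewrite rE ceil_ge0 (lt_le_trans _ L0)// ltrN10.
case: r rE r0 => [r|//] rE _.
have Lr : L <= r%:R by have := ceil_ge L; rewrite -rE.
have xR2 i : \sum_k x i k 0 ^+ 2 <= R ^+ 2 by rewrite -euclid_norm_le ?(ltW R0).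
have yR2 j : \sum_k y j k 0 ^+ 2 <= R ^+ 2 by rewrite -euclid_norm_le ?(ltW R0).
have [D [u [v [uv2 uvE]]]] := exists_gram_wnorm m0 posW R0.
pose z i j := wnorm W (x i - y j) ^+ 2.
(* Coordinatewise, [(a - b)^2 <= 2 a^2 + 2 b^2] bounds the squared distance by [4 * R ^+ 2]. *)
have zrho i j : 0 <= z i j <= rho.
  rewrite sqr_ge0 /z (le_trans (wnorm_sqr_le m0 posW _))// -/S /rho.
  rewrite [4 * S]mulrC -mulrA ler_wpM2l ?(ltW S0)//.
  apply: (@le_trans _ _ (\sum_k (2 * x i k 0 ^+ 2 + 2 * y j k 0 ^+ 2))).
    apply: ler_sum => k' _; rewrite !mxE.
    by have := sqr_ge0 (x i k' 0 + y j k' 0); nra.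
  rewrite big_split /= -!mulr_sumr; have := xR2 i; have := yR2 j; lra.
have /choice[B HB] s : exists B : 'M[K]_(n1, n2), (\rank B <= r)%N /\
    forall i j, `|z i j ^+ s - B i j| <= eps * rho ^+ s.
  have [B [rB HB]] := exists_low_rank_power s n10 n20 eps01 Lr
    (fun i => proj1 (uv2 _ (xR2 i))) (fun j => proj2 (uv2 _ (yR2 j))).
  by exists B; split=> // i j; have := HB i j; rewrite uvE.
pose a s := nderive_within Omega s h 0 / s`!%:R.
have b0 : 0 <= 4 * sigma * R ^+ 2 by rewrite !mulr_ge0 ?exprn_ge0// ltW.
have bO : `[0, 4 * sigma * R ^+ 2] `<=` Omega.
  by apply: subset_trans itvO; apply: subset_itvr; rewrite bnd_simp oppr_le0.
have aM s : `|a s| <= C * (M ^+ s / s`!%:R).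
  rewrite /a normrM normfV (ger0_norm (ler0n _ _)) mulrA ler_wpM2r ?invr_ge0//.
  rewrite -lee_fin; apply: le_trans (hM s).
  apply: ereal_sup_ubound; exists 0 => //; apply: bO.
  by rewrite /= in_itv /= lexx.
(* The zeroth Hadamard power is constant and kept exactly: it costs rank 1 and no error, whence the
   [- 1] after the exponential in the bound. *)
pose G := const_mx (a 0%N) + \sum_(s < k) a s.+1 *: B s.+1.
exists G; split.
  rewrite (_ : 1 + (Posz k.+1 - 1) * Posz r = (1 + k * r)%N); last first.
    by rewrite -[k.+1]addn1 PoszD addrK PoszD PoszM.
  rewrite lez_nat; apply: leq_trans (mxrank_add _ _) _.
  rewrite leq_add ?mxrank_const_le1//; apply: mxrank_sum_le => s.
  apply: leq_trans (mxrank_scale _ _) _; exact: (HB _).1.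
have eM0 : 0 <= expR (M * rho) - 1 by rewrite subr_ge0 -expR0 ler_expR ltW.
apply: mx_norm_le => [|i j].
  by rewrite mulr_ge0// addr_ge0 ?expR_ge0// mulr_ge0// ltW.
have /andP[z0 z1] := zrho i j.
have zb : z i j \in `[0, 4 * sigma * R ^+ 2]%R.
  rewrite in_itv /= z0 /= (le_trans z1)// /rho.
  by rewrite ler_wpM2r ?exprn_ge0 ?(ltW R0)// ler_wpM2l.
have taylor : `|h (z i j) - \sum_(s < k.+1) a s * z i j ^+ s| <= C * expR (- k.+1%:R).
  have := taylor_within_le k.+1 bO smh hM zb.
  under eq_bigr do rewrite mulrA mulrAC.
  move=> /le_trans; apply; rewrite -mulrA ler_wpM2l// mulrA -exprMn.
  apply: pow_fact_le; first by rewrite mulr_ge0// ltW.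
  by apply: le_trans tE'; rewrite !ler_wpM2l ?exprn_ge0 ?expR_ge0// ltW.
(* The error splits into the Taylor remainder and the errors of the approximated powers, from
   [s = 1] on. *)
have -> : (F - G) i j = (h (z i j) - \sum_(s < k.+1) a s * z i j ^+ s)
    + \sum_(s < k) a s.+1 * (z i j ^+ s.+1 - B s.+1 i j).
  rewrite big_ord_recl /= expr0 mulr1 !mxE FE -/(z i j) summxE.
  under [X in _ = _ + X]eq_bigr do rewrite mulrBr.
  rewrite sumrB (eq_bigr (fun s : 'I_k => a s.+1 * B s.+1 i j)) => [|s _]; last first.
    by rewrite mxE.
  by ring.
apply: (le_trans (ler_normD _ _)); rewrite mulrDr lerD//.
apply: le_trans (ler_norm_sum _ _ _) _.
apply: (@le_trans _ _ (\sum_(s < k) C * (eps * ((M * rho) ^+ s.+1 / s.+1`!%:R)))).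
  apply: ler_sum => s _; rewrite normrM.
  apply: le_trans (ler_pM _ _ (aM s.+1) ((HB s.+1).2 i j)) _ => //.
  rewrite [leRHS](_ : _ = C * (M ^+ s.+1 / s.+1`!%:R) * (eps * rho ^+ s.+1))//.
  by rewrite [(M * rho) ^+ _]exprMn; ring.
rewrite -!mulr_sumr !ler_wpM2l ?(ltW e0)//.
exact: exp_tail_sum_le (ltW Mrho0).
Qed.
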